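(* Let $r>0$ and let $M$ be a finite set endowed with two metrics $d_0$ and $d_1$ such that for all $x,y\in M$ $$|d_0(x,y)-d_1(x,y)|\le 2r,$$ and such that for $i=0,1$ the metric space $(M,d_i)$ embeds into $L_1$ with distortion at most $D_i$. Suppose also that there exist a constant $K\ge 1$ and a map $\psi:M\to L_1$ such that for all $x,y\in M$ $$\min\{d_0(x,y),d_1(x,y)\}\le \|\psi(x)-\psi(y)\|\le K\min\{d_0(x,y),d_1(x,y)\}.$$ Then the $r$-twisted union $(M\times\mathbb{F}_2,d)$ of $(M,d_0)$ and $(M,d_1)$ embeds into $L_1$ with distortion bounded by a constant $D$ that depends only on $D_0$, $D_1$ and $K$ (in particular, not on $M$, $d_0$, $d_1$, or $r$).
   Context: $\mathbb{F}_2=\{0,1\}$. $L_1$ stands for a space $L_1(\Omega,\Sigma,\mu)$, with its norm $\|\cdot\|$; embedding into $L_1$ means embedding into some such space. An injective map $F:(X,d_X)\to(Y,d_Y)$ between metric spaces is a bilipschitz embedding if there are $C_1,C_2>0$ with $C_1d_X(u,v)\le d_Y(F(u),F(v))\le C_2d_X(u,v)$ for all $u,v\in X$; its distortion is $\mathrm{Lip}(F)\cdot\mathrm{Lip}(F^{-1}|_{F(X)})$, where $\mathrm{Lip}$ denotes the Lipschitz constant. Twisted union: Let $M$ be a finite set endowed with two metrics $d_0,d_1$ and let $r>0$ be a constant such that $|d_0(x,y)-d_1(x,y)|\le 2r$ for all $x,y\in M$. The $r$-twisted union of $(M,d_0)$ and $(M,d_1)$ is the set $M\times\mathbb{F}_2$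 with the metric $d$ defined as the shortest path metric of the weighted graph on $M\times\mathbb{F}_2$ with the following edges: for all $x,y\in M$, an edge between $(x,0)$ and $(y,0)$ of weight $d_0(x,y)$; for all $x,y\in M$, an edge between $(x,1)$ and $(y,1)$ of weight $d_1(x,y)$; for every $x\in M$, an edge between $(x,0)$ and $(x,1)$ of weight $r$. *)

(* Defs.v *)
From HB Require Import structures.
From mathcomp Require Import all_boot all_order all_algebra.
From mathcomp Require Import all_classical all_reals all_analysis.

Set Implicit Arguments.
Unset Strict Implicit.
Unset Printing Implicit Defensive.

Import Order.TTheory GRing.Theory Num.Theory.
Import numFieldNormedType.Exports.

Local Open Scope classical_set_scope.
Local Open Scope ring_scope.

Definition is_metric (R : realType) (X : Type) (d : X -> X -> R) : Prop :=
  [/\ forall x y, 0 <= d x y,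
      forall x y, d x y = 0 <-> x = y,
      forall x y, d x y = d y x &
      forall x y z, d x z <= d x y + d y z].

(* [LspaceType1 mu] has no vector space structure in the library, so ||f - g||
   is computed on the representatives to which f and g coerce; the result does
   not depend on them, and [fine] is applied to a finite value. *)
Definition L1dist (R : realType) (disp : measure_display)
    (T : measurableType disp) (mu : {measure set T -> \bar R})
    (f g : LspaceType1 mu) : R :=
  fine ('N[mu]_1 [EFin \o ((f : T -> R) \- (g : T -> R))%R])%E.

(* The Lipschitz constant; [inf] of the empty set is 0, so this is meaningful
   only when F is Lipschitz. *)
Definition Lip (R : realType) (X Y : Type) (dX : X -> X -> R) (dY : Y -> Y -> R)
    (F : X -> Y) : R :=
  inf [set C : R | 0 <= C /\ forall u v, dY (F u) (F v) <= C * dX u v].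

(* For injective F, the inverse of F on its image. *)
Definition range_inv (X Y : Type) (F : X -> Y) (y : set_type (range F)) : X :=
  s2val (cid2 (set_mem (svalP y))).

Definition bilipschitz_embedding (R : realType) (X Y : Type)
    (dX : X -> X -> R) (dY : Y -> Y -> R) (F : X -> Y) : Prop :=
  injective F /\
  exists C1 C2 : R, [/\ 0 < C1, 0 < C2 &
    forall u v, C1 * dX u v <= dY (F u) (F v) <= C2 * dX u v].

Definition distortion (R : realType) (X Y : Type)
    (dX : X -> X -> R) (dY : Y -> Y -> R) (F : X -> Y) : R :=
  Lip dX dY F *
  Lip (fun y z : set_type (range F) => dY (sval y) (sval z)) dX (@range_inv X Y F).

Definition L1_embeds_with_distortion (R : realType) (X : Type)
    (dX : X -> X -> R) (D : R) : Prop :=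
  exists (disp : measure_display) (T : measurableType disp)
    (mu : {measure set T -> \bar R}) (F : X -> LspaceType1 mu),
    bilipschitz_embedding dX (@L1dist R disp T mu) F /\
    distortion dX (@L1dist R disp T mu) F <= D.

(* Infimum of the lengths of the walks u = p_0, p_1, ..., p_k = v in the graph
   with adjacency relation e and edge weights w. *)
Definition shortest_path_dist (R : realType) (V : eqType) (e : rel V)
    (w : V -> V -> R) (u v : V) : R :=
  inf [set l : R | exists p : seq V,
    [/\ path e u p, last u p = v & l = \sum_(a <- pairmap w u p) a]].

Definition twisted_edge (M : finType) : rel (M * 'F_2) :=
  fun u v => (u.2 == v.2) || (u.1 == v.1).

Definition twisted_weight (R : realType) (M : finType) (d0 d1 : M -> M -> R)
    (r : R) (u v : M * 'F_2) : R :=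
  if u.2 == v.2 then (if u.2 == 0 then d0 u.1 v.1 else d1 u.1 v.1) else r.

Definition twisted_union_dist (R : realType) (M : finType) (d0 d1 : M -> M -> R)
    (r : R) : M * 'F_2 -> M * 'F_2 -> R :=
  shortest_path_dist (@twisted_edge M) (twisted_weight d0 d1 r).

(* Main.v *)
Require Import Defs.
From HB Require Import structures.
From mathcomp Require Import all_boot all_order all_algebra.
From mathcomp Require Import all_classical all_reals all_analysis.
From mathcomp Require Import measurable_realfun lra.

Set Implicit Arguments.
Unset Strict Implicit.
Unset Printing Implicit Defensive.

Import Order.TTheory GRing.Theory Num.Theory.
Import numFieldNormedType.Exports.

Local Open Scope classical_set_scope.
Local Open Scope ring_scope.

(** On a finite set M, an L_1 metric is a nonnegative combination
    [\sum_S lambda_S |1_S(x) - 1_S(y)|] of cut metrics: for real-valued functions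
    this is the layer-cake formula, which is then integrated.

    Cut combinations can be truncated inside L_1.  Keep each cut S independently
    with probability [lambda_S / (1 + lambda_S)] and send x to the pattern of its
    memberships in the kept cuts; x and y are separated with probability
    [1 - \prod_(S separates x, y) (1 + lambda_S)^-1], which is comparable to
    [min(1, t)], where t is the value of the combination at (x, y).  The law of
    the pattern of x is a unit vector G(x) of a finite-dimensional l_1 space, so
    [|G(x) - G(y)|] is comparable to [min(1, t)].

    Applied to [d_i / r] this gives bounded maps G_i.  The twisted union is
    embedded by sending (x, i) to [psi(x)] together with [r G_i(x)] in the i-th of
    two disjoint blocks of coordinates.  Within a layer, [psi] sees [min(d_0, d_1)] and [r G_i]
    sees [min(r, d_i)], which suffices because [d_i <= min(d_0, d_1) + 2 r]; across
    layers the two blocks contribute exactly [2 r]. *)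

(** * Cut decomposition of a real-valued function on a finite set *)

Section Cuts.
Context {R : realType} {M : finType}.
Implicit Types (v : M -> R) (S : {set M}).

(* The length of the set of levels t with [v > t] exactly on S.  The default
   value of the minimum dominates every term, so it matters only for S empty or
   full, where no pair is separated; it keeps the gap integrable in v. *)
Definition cut_gap v S : R :=
  Num.max 0 (\big[Num.min/ \sum_p `|v p.1 - v p.2|]_(p : M * M |
    (p.1 \in S) && (p.2 \notin S)) (v p.1 - v p.2)).

Lemma cut_gap_ge0 v S : 0 <= cut_gap v S.
Proof. by rewrite le_max lexx. Qed.

Lemma cut_gap_le v S : cut_gap v S <= \sum_(p : M * M) `|v p.1 - v p.2|.
Proof.
rewrite ge_max sumr_ge0//=.
elim/big_rec: _ => // p x _ h.
by rewrite ge_min h orbT.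
Qed.

(** A pair with [v a <= v b] puts a nonpositive term into the minimum, which the outer maximum turns
    into 0. *)
Lemma cut_gap_lt v S a b : cut_gap v S != 0 -> a \in S -> b \notin S -> v b < v a.
Proof.
move=> h aS bS; rewrite ltNge; apply/negP => hba; case/eqP: h.
apply/max_idPl.
rewrite (bigD1 (a, b)) /= ?aS ?bS// ge_min; apply/orP; left; lra.
Qed.

Lemma cut_gap_superlevel v x y : v x < v y ->
  (forall z, v x < v z -> v y <= v z) ->
  cut_gap v [set z | v x < v z]%SET = v y - v x.
Proof.
move=> xy hmin; rewrite /cut_gap.
set m := \big[_/_]_(_ | _) _; have -> : m = v y - v x.
  apply/eqP; rewrite eq_le; apply/andP; split.
    by rewrite /m (bigD1 (y, x)) /= ?inE ?xy ?ltxx// ge_min lexx.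
  rewrite /m; elim/big_rec: _ => [|p s]; rewrite ?inE.
    by rewrite (bigD1 (y, x))//= (le_trans (ler_norm _))// lerDl sumr_ge0.
  move=> /andP[p1 p2] hs; rewrite le_min hs andbT.
  have := hmin _ p1; move: p2; rewrite -leNgt; lra.
by apply/max_idPr; lra.
Qed.

(* The cut [v > v x] is the only one of positive gap that separates x from the
   next higher point z; the other cuts below y are those that separate z from y. *)
Lemma sum_cut_gap_le v x y : v x <= v y ->
  v y - v x = \sum_(S : {set M} | (y \in S) && (x \notin S)) cut_gap v S.
Proof.
have [n] := ubnP #|[set z | v x < v z]%SET|.
elim: n x => // n IH x hn xy.
have [e|ne] := eqVneq (v x) (v y).
  rewrite e subrr big1// => S /andP[yS xS].
  apply/eqP; rewrite -[_ == _]negbK; apply/negP => /cut_gap_lt /(_ yS xS).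
  by rewrite e ltxx.
have {ne}xy : v x < v y by rewrite lt_neqAle ne.
have [z xz hmin] : exists2 z, v x < v z & forall t, v x < v t -> v z <= v t.
  by case: (@arg_minP _ _ _ y (fun z => v x < v z) v xy) => z; exists z.
have hsub : (#|[set t | (v z < v t)%R]%SET| < n)%N.
  rewrite ltnS in hn; apply: leq_trans hn; apply: proper_card.
  apply/properP; split.
    by apply/fintype.subsetP => t; rewrite !inE; apply: lt_trans.
  by exists z; rewrite !inE ?ltxx.
have E := IH z hsub (hmin _ xy).
rewrite (bigD1 [set t | v x < v t]%SET) /= ?inE ?xy ?ltxx//.
rewrite (cut_gap_superlevel xz hmin).
suff -> : \sum_(S : {set M} | (y \in S) && (x \notin S) &&
    (S != [set t | v x < v t]%SET)) cut_gap v S = v y - v z by lra.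
rewrite E big_mkcond [RHS]big_mkcond /=; apply: eq_bigr => S _.
have [->|gS] := eqVneq (cut_gap v S) 0; first by rewrite !if_same.
case yS: (y \in S) => //=.
have [zS|zS] := boolP (z \in S) => /=; last first.
  have [xS|xS] := boolP (x \in S).
    by have := cut_gap_lt gS xS zS; rewrite ltNge (ltW xz).
  by rewrite ifT//=; apply: contraNneq zS => ->; rewrite inE.
have [xS|xS] //= := boolP (x \in S).
(* A cut of nonzero gap with z inside and x outside must be the superlevel set of [v x], the one cut
   taken out of the sum. *)
rewrite ifF//; apply/negbF; apply/eqP/setP => t; rewrite inE.
apply/idP/idP => ht; first exact: cut_gap_lt gS ht xS.
have := hmin _ ht; apply: contraTT => tS; rewrite -ltNge.
exact: cut_gap_lt gS zS tS.
Qed.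

Lemma sum_cut_gap v x y :
  `|v x - v y| = \sum_(S : {set M}) cut_gap v S * ((x \in S) != (y \in S))%:R.
Proof.
wlog xy : x y / v x <= v y => [H|].
  have [|/ltW] := leP (v x) (v y); first exact: H.
  by move=> /H; rewrite distrC => ->; apply: eq_bigr => S _; rewrite eq_sym.
rewrite distrC ger0_norm ?subr_ge0// sum_cut_gap_le// big_mkcond.
apply: eq_bigr => S _.
have [->|gS] := eqVneq (cut_gap v S) 0; first by rewrite if_same mul0r.
have [xS|xS] := boolP (x \in S); have [yS|yS] := boolP (y \in S);
 rewrite ?mulr0 ?mulr1//.
by have := cut_gap_lt gS xS yS; rewrite ltNge xy.
Qed.

End Cuts.

(** * Truncation of cut metrics by random families of cuts *)

Section Saturation.
Context {R : realFieldType} {M : finType}.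
Implicit Types (lambda : {set M} -> R) (x y : M).

Definition cut_dist lambda x y : R :=
  \sum_S lambda S * ((x \in S) != (y \in S))%:R.

(** The probability that some kept cut separates x and y: the product is the probability that every
    separating cut is dropped. *)
Definition saturation lambda x y : R :=
  1 - \prod_(S : {set M})
        (if (x \in S) != (y \in S) then (1 + lambda S)^-1 else 1).

Definition cut_family_prob lambda (E : {set {set M}}) : R :=
  \prod_(S : {set M})
    (if S \in E then lambda S / (1 + lambda S) else (1 + lambda S)^-1).

(** The joint law of the kept family E and the set V of its members containing x. Recording E lets x
    and y be compared family by family. *)
Definition random_cuts lambda x (EV : {set {set M}} * {set {set M}}) : R :=
  cut_family_prob lambda EV.1 *
  (EV.2 == [set S in EV.1 | x \in (S : {set M})]%SET)%:R.

Lemma cut_distZ t lambda x y :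
  cut_dist (fun S => t * lambda S) x y = t * cut_dist lambda x y.
Proof. by rewrite mulr_sumr; apply: eq_bigr => S _; rewrite mulrA. Qed.

(** Let t be the cut distance and q the product. Expanding the product of the [1 + lambda S] gives
    [q <= 1 / (1 + t)], and a union bound gives [1 - t <= q]. Then [t / (1 + t) <= 1 - q <= t], and
    [min(1, t) <= 2 t / (1 + t)]. *)
Lemma saturation_bounds lambda x y : (forall S, 0 <= lambda S) ->
  Num.min 1 (cut_dist lambda x y) <= 2 * saturation lambda x y
    <= 2 * cut_dist lambda x y.
Proof.
move=> l0; rewrite /saturation /cut_dist.
suff : let q := \prod_(S : {set M})
      (if (x \in S) != (y \in S) then (1 + lambda S)^-1 else 1) in
  let t := cut_dist lambda x y in
  [/\ 0 <= t, 0 < q, q * (1 + t) <= 1 & 1 - t <= q].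
  rewrite /= /cut_dist; set q := \prod_(S : {set M}) _; set t := \sum_S _.
  move=> [t0 q0 qt1 tq].
  rewrite ge_min; apply/andP; split; last lra.
  have [t1|t1] := leP 1 t; apply/orP; [left|right]; nra.
rewrite /= /cut_dist.
elim/big_rec2: _ => [|S t q _ [t0 q0 qt1 tq]]; first by split; lra.
have lS := l0 S; case: ifP => _; rewrite ?mulr1 ?mulr0; last by split; lra.
set s := (1 + lambda S)^-1.
have s0 : 0 < s by rewrite invr_gt0; lra.
have sE : s * (1 + lambda S) = 1 by rewrite mulVf// gt_eqF//; lra.
set l := lambda S in lS sE *.
have sl0 : 0 <= s * l by rewrite mulr_ge0// ltW.
have s1 : s <= 1 by lra.
have qt : 0 <= q * t by rewrite mulr_ge0// ltW.
have q1 : q <= 1 by lra.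
have sl : s * l <= l by rewrite ler_piMl.
have st : s * t <= t by rewrite ler_piMl.
have slq : s * l * q <= s * l by rewrite ler_piMr// mulr_ge0// ltW.
have sq1 : s * (q * (1 + t)) <= s by rewrite ler_piMr// ltW.
have sqt : s * (1 - t) <= s * q by rewrite ler_pM2l.
by split; [lra|exact: mulr_gt0|lra|lra].
Qed.

Lemma cut_family_prob_ge0 lambda E : (forall S, 0 <= lambda S) ->
  0 <= cut_family_prob lambda E.
Proof.
move=> l0; apply: prodr_ge0 => S _.
by case: ifP => _; rewrite ?divr_ge0 ?invr_ge0// addr_ge0.
Qed.

Lemma sum_cut_family_prob lambda : (forall S, 0 <= lambda S) ->
  \sum_E cut_family_prob lambda E = 1.
Proof.
move=> l0; rewrite /cut_family_prob -bigA_distr big1// => S _.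
by rewrite /= -[X in _ + X]mul1r -mulrDl addrC divff// gt_eqF// ltr_pwDl.
Qed.

Lemma sum_random_cuts lambda x : (forall S, 0 <= lambda S) ->
  \sum_EV `|random_cuts lambda x EV| = 1.
Proof.
move=> l0.
rewrite -(pair_bigA _ (fun E V => `|random_cuts lambda x (E, V)|)) /=.
transitivity (\sum_E cut_family_prob lambda E).
  apply: eq_bigr => E _.
  rewrite (bigD1 [set S in E | x \in (S : {set M})]%SET)//= big1.
    by rewrite addr0 /random_cuts /= eqxx mulr1 ger0_norm// cut_family_prob_ge0.
  by move=> V /negPf nV; rewrite /random_cuts /= nV mulr0 normr0.
exact: sum_cut_family_prob.
Qed.

(** For fixed E both vectors are point masses of weight [p E], at distance 0 if the patterns agree
    and [2 * p E] otherwise. The patterns agree exactly when E contains no separating cut. *)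
Lemma random_cuts_dist lambda x y : (forall S, 0 <= lambda S) ->
  \sum_EV `|random_cuts lambda x EV - random_cuts lambda y EV|
  = 2 * saturation lambda x y.
Proof.
move=> l0.
pose p := cut_family_prob lambda.
pose c z (E : {set {set M}}) : {set {set M}} :=
  [set S in E | z \in (S : {set M})]%SET.
rewrite -(pair_bigA _ (fun E V =>
  `|random_cuts lambda x (E, V) - random_cuts lambda y (E, V)|)) /=.
transitivity (2 * (\sum_E p E - \sum_E p E * (c x E == c y E)%:R)).
  rewrite -sumrB mulr_sumr; apply: eq_bigr => E _.
  transitivity (\sum_V p E * `|(V == c x E)%:R - (V == c y E)%:R|).
    apply: eq_bigr => V _; rewrite /random_cuts /= -mulrBr normrM.
    by rewrite ger0_norm// cut_family_prob_ge0.
  rewrite -mulr_sumr -[X in 2 * (X - _)]mulr1 -mulrBr mulrCA; congr (_ * _).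
  have [->|ne] := eqVneq (c x E) (c y E).
    by rewrite big1 ?subrr ?mulr0// => V _; rewrite subrr normr0.
  rewrite (bigD1 (c x E))//= (bigD1 (c y E)) 1?eq_sym//= big1.
    rewrite !eqxx eq_sym (negPf ne) /= subr0 sub0r normrN normr1; lra.
  by move=> V /andP[/negPf -> /negPf ->]; rewrite subrr normr0.
rewrite sum_cut_family_prob// /saturation; congr (2 * (1 - _)).
(* Forbidding the separating cuts sets their selection probability to 0. *)
transitivity (\sum_(E : {set {set M}}) \prod_(S : {set M}) (if S \in E then
   (if (x \in S) != (y \in S) then 0 else lambda S / (1 + lambda S))
   else (1 + lambda S)^-1)).
  apply: eq_bigr => E _; have [e|ne] := eqVneq (c x E) (c y E).
    rewrite mulr1; apply: eq_bigr => S _; case: ifP => // SE.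
    by move/setP/(_ S): e; rewrite !inE SE /= => ->; rewrite eqxx.
  rewrite mulr0; apply/esym/eqP/prodf_eq0.
  have [S _ hS] : exists2 S : {set M}, true & (S \in c x E) != (S \in c y E).
    apply/exists_inP; apply: contraNT ne => /exists_inPn H.
    by apply/eqP/setP => S; apply/eqP; rewrite -[_ == _]negbK H.
  move: hS; rewrite !inE; case SE: (S \in E) => //= hS.
  by exists S => //; rewrite SE hS.
rewrite -bigA_distr; apply: eq_bigr => S _.
case: ifP => _; first by rewrite /= add0r.
by rewrite /= -[X in _ + X]mul1r -mulrDl addrC divff// gt_eqF// ltr_pwDl.
Qed.

End Saturation.

(** * Points of L_1 as classes of functions, and cut decomposition of L_1 metrics *)

Section L1class.
Local Open Scope quotient_scope.

Lemma repr_ae_eq d1 d2 (R : realType) (T1 : measurableType d1)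
    (T2 : measurableType d2) (mu : {measure set T1 -> \bar R})
    (f : {mfun T1 >-> T2}) :
  (repr (\pi_({mfun_ mu, T1 >-> T2}) f) : T1 -> T2) = f %[ae mu].
Proof.
set q := \pi_({mfun_ mu, T1 >-> T2}) f.
have : \pi_({mfun_ mu, T1 >-> T2}) (repr q) == q by rewrite reprK.
by rewrite eqmodE => /asboolP.
Qed.

Context (R : realType) (disp : measure_display) (T : measurableType disp).
Variable mu : {measure set T -> \bar R}.

Lemma measurable_mfunR (f : {mfun T >-> measurableTypeR R}) :
  measurable_fun setT (f : T -> R).
Proof. by have h := @measurable_funPT _ _ _ _ f; exact h. Qed.

Definition ae_class (f : {mfun T >-> measurableTypeR R}) :
    {mfun_ mu, T >-> measurableTypeR R} :=
  \pi_({mfun_ mu, T >-> measurableTypeR R}) f.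

Lemma ae_classE (f : {mfun T >-> measurableTypeR R}) :
  (ae_class f : T -> R) = f %[ae mu].
Proof. by have h := repr_ae_eq mu f; exact h. Qed.

Lemma finite_norm_class (f : {mfun T >-> measurableTypeR R}) :
  finite_norm mu 1 f -> finite_norm mu 1 (ae_class f).
Proof.
rewrite /finite_norm !Lnorm1 => finf.
rewrite (@ae_eq_integral _ _ _ mu setT (fun x => `|(EFin \o f) x|)%E)//.
- apply: measurableT_comp => //; apply/measurable_EFinP.
  exact: measurable_mfunR (repr (ae_class f)).
- apply: measurableT_comp => //; apply/measurable_EFinP.
  exact: measurable_mfunR f.
- by apply: filterS (ae_classE f) => x h _ /=; rewrite h.
Qed.

Definition L1class (f : {mfun T >-> measurableTypeR R})
    (finf : finite_norm mu 1 f) : LspaceType1 mu :=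
  LebesgueSpace.Pack (LebesgueSpace.Class
    (isFinLebesgue.Build _ _ _ mu _ (@lexx _ _ 1%E) _ (finite_norm_class finf))).

Lemma L1dist_class (f g : {mfun T >-> measurableTypeR R})
    (finf : finite_norm mu 1 f) (fing : finite_norm mu 1 g) :
  L1dist (L1class finf) (L1class fing) =
    fine (\int[mu]_x `|(f x : R) - g x|%:E)%E.
Proof.
rewrite /L1dist Lnorm1; congr fine; apply: ae_eq_integral => //.
- apply: measurableT_comp => //; apply/measurable_EFinP.
  apply: measurable_funB; first exact: measurable_mfunR (repr (ae_class f)).
  exact: measurable_mfunR (repr (ae_class g)).
- apply/measurable_EFinP; apply: measurableT_comp => //.
  apply: measurable_funB; exact: measurable_mfunR.
- apply: filterS2 (ae_classE f) (ae_classE g) => x hf hg _ /=.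
  by rewrite hf// hg.
Qed.

(** The decomposition [sum_cut_gap] holds at each point t for the function [x |-> psi x t].
    Integrating over t gives the weights. *)
Lemma L1dist_cut_decomposition (M : finType) (psi : M -> LspaceType1 mu) :
  exists2 lambda : {set M} -> R, forall S, 0 <= lambda S &
  forall x y, L1dist (psi x) (psi y) = cut_dist lambda x y.
Proof.
pose v t x : R := psi x t.
have mpsi x : measurable_fun setT (v ^~ x).
  pose f : {mfun_ mu, T >-> measurableTypeR R} := psi x.
  by have h := measurable_mfunR (repr f); exact h.
have ipsi x : mu.-integrable setT (EFin \o v ^~ x).
  apply/integrableP; split; first exact/measurable_EFinP.
  have : finite_norm mu 1 (psi x : T -> R) by exact: Lebesgue_finite.
  by rewrite /finite_norm Lnorm1.
have idiff x y : mu.-integrable setT (fun t => `|v t x - v t y|%:E).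
  have /integrable_abse := integrableB measurableT (ipsi x) (ipsi y).
  exact.
have mgap S : measurable_fun setT (fun t => cut_gap (v t) S).
  apply: (@measurable_maxr _ _ _ _ (cst 0) _) => //.
  pose D t := \sum_(p : M * M) `|v t p.1 - v t p.2|.
  have mD : measurable_fun setT D.
    apply: measurable_sum => p; apply: measurableT_comp => //.
    exact: measurable_funB.
  (* Generalizing to an arbitrary list of pairs allows induction, with the default value [D t] as
     base case. *)
  suff H r : measurable_fun setT (fun t => \big[Num.min/D t]_(p <- r |
      (p.1 \in S) && (p.2 \notin S)) (v t p.1 - v t p.2)) by exact: H.
  elim: r => [|p r IH].
    by apply: eq_measurable_fun mD => t _; rewrite big_nil.
  case E : ((p.1 \in S) && (p.2 \notin S)); last first.
    by apply: eq_measurable_fun IH => t _; rewrite big_cons E.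
  have mp := measurable_funB (mpsi p.1) (mpsi p.2).
  apply: eq_measurable_fun (measurable_minr mp IH).
  by move=> t _; rewrite big_cons E.
have igap S : mu.-integrable setT (fun t => (cut_gap (v t) S)%:E).
  apply: (@le_integrable _ _ _ _ _ _ _
    (fun t => (\sum_(p : M * M) `|v t p.1 - v t p.2|)%:E)) => //.
  - exact/measurable_EFinP.
  - move=> t _; rewrite lee_fin ger0_norm ?cut_gap_ge0// ger0_norm ?sumr_ge0//.
    exact: cut_gap_le.
  - under eq_fun do rewrite -sumEFin.
    apply: integrable_sum => // p _; exact: idiff.
exists (fun S => fine (\int[mu]_t (cut_gap (v t) S)%:E)%E) => [S|x y].
  by apply/fine_ge0/integral_ge0 => t _; rewrite lee_fin cut_gap_ge0.
have iS S : mu.-integrable setT (fun t =>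
    (cut_gap (v t) S * ((x \in S) != (y \in S))%:R)%:E).
  under eq_fun do rewrite EFinM.
  exact: integrableZr.
rewrite /L1dist Lnorm1.
under eq_integral => t _ do rewrite /= -/(v t x) -/(v t y) sum_cut_gap -sumEFin.
rewrite integral_sum// -sum_fine => [|S _]; last exact: integrable_fin_num.
apply: eq_bigr => S _.
under eq_integral do rewrite EFinM.
by rewrite integralZr//= fineM//; exact: integrable_fin_num.
Qed.

End L1class.

(** * Lipschitz constants and distortion *)

Section Lipschitz.
Context (R : realType) (X Y : Type) (dX : X -> X -> R) (dY : Y -> Y -> R).

Lemma Lip_ge0 (F : X -> Y) : 0 <= Lip dX dY F.
Proof.
rewrite /Lip; set A := [set C | _].
have [->|/set0P A0] := eqVneq A set0; first by rewrite inf0.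
by apply: lb_le_inf => // C [].
Qed.

Lemma Lip_le (F : X -> Y) (C : R) : 0 <= C ->
  (forall u v, dY (F u) (F v) <= C * dX u v) -> Lip dX dY F <= C.
Proof. by move=> C0 FC; apply: ge_inf; [exists 0 => ? []|split]. Qed.

(** The infimum is itself admissible. The given C settles pairs at distance 0 and makes the set
    nonempty. *)
Lemma le_Lip (F : X -> Y) (C : R) : (forall u v, 0 <= dX u v) -> 0 <= C ->
  (forall u v, dY (F u) (F v) <= C * dX u v) ->
  forall u v, dY (F u) (F v) <= Lip dX dY F * dX u v.
Proof.
move=> dX0 C0 FC u v.
have [d0|d0] := eqVneq (dX u v) 0; first by have := FC u v; rewrite d0 !mulr0.
have d_gt0 : 0 < dX u v by rewrite lt_def d0 dX0.
rewrite -ler_pdivrMr//; apply: lb_le_inf; first by exists C.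
by move=> B [_ FB]; rewrite ler_pdivrMr.
Qed.

Lemma range_invK (F : X -> Y) (y : set_type (range F)) : F (range_inv y) = sval y.
Proof. by rewrite /range_inv; case: cid2. Qed.

End Lipschitz.

Lemma distortion_le (R : realType) (X Y : Type) (dX : X -> X -> R)
    (dY : Y -> Y -> R) (F : X -> Y) (c C : R) : 0 < c -> 0 <= C ->
  (forall u v, c * dX u v <= dY (F u) (F v) <= C * dX u v) ->
  distortion dX dY F <= C / c.
Proof.
move=> c0 C0 FcC; apply: ler_pM; rewrite ?Lip_ge0//.
  by apply: Lip_le => // u v; case/andP: (FcC u v).
apply: Lip_le => [|y z]; first by rewrite invr_ge0 ltW.
rewrite -!range_invK mulrC ler_pdivlMr// mulrC.
by case/andP: (FcC (range_inv y) (range_inv z)).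
Qed.

(** The factor b is the Lipschitz constant of the inverse: scaling by it makes F noncontracting and
    turns its Lipschitz constant into the distortion. *)
Lemma distortion_rescaling (R : realType) (X Y : Type) (dX : X -> X -> R)
    (dY : Y -> Y -> R) (F : X -> Y) :
  (forall u v, 0 <= dX u v) -> (forall y z, 0 <= dY y z) ->
  bilipschitz_embedding dX dY F ->
  exists2 b : R, 0 <= b & forall u v,
  dX u v <= b * dY (F u) (F v) <= distortion dX dY F * dX u v.
Proof.
move=> dX0 dY0 [injF [c [C [c0 C0 FcC]]]].
pose dF (y z : set_type (range F)) := dY (sval y) (sval z).
exists (Lip dF dX (@range_inv X Y F)).
  exact: Lip_ge0.
move=> u v; apply/andP; split; last first.
  rewrite /distortion mulrAC [leRHS]mulrC; apply: ler_wpM2l; first exact: Lip_ge0.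
  by apply: (@le_Lip _ _ _ _ _ _ C) => // [|x y]; [exact: ltW|case/andP: (FcC x y)].
pose y w : set_type (range F) := SigSub (mem_set (imageP F (I : setT w))).
have yK w : range_inv (y w) = w by apply: injF; rewrite range_invK.
rewrite -{1}(yK u) -{1}(yK v) -/(dF (y u) (y v)).
apply: (@le_Lip _ _ _ dF _ _ c^-1) => [s t||s t].
- exact: dY0.
- by rewrite invr_ge0 ltW.
- rewrite /dF -!range_invK mulrC ler_pdivlMr// mulrC.
  by case/andP: (FcC (range_inv s) (range_inv t)).
Qed.

(** * Finite-dimensional l_1 as an L_1 space, and cut weights from an embedding *)

Section FiniteL1.
Context (R : realType) (I : finType).

(** A vector becomes a function on [nat], where every function is measurable. The indices with
    default value 0 carry no mass in [finite_counting]. *)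
Definition ord_extend (a : I -> R) (k : nat) : measurableTypeR R :=
  if insub k is Some i then a (enum_val (i : 'I_#|I|)) else (0 : R).

Lemma measurable_ord_extend a : measurable_fun setT (ord_extend a).
Proof. by []. Qed.

HB.instance Definition _ a := isMeasurableFun.Build _ _ nat (measurableTypeR R)
  (ord_extend a) (measurable_ord_extend a).

Definition finite_counting : {measure set nat -> \bar R} :=
  msum (fun k => \d_k) #|I|.

Lemma integral_finite_counting (f : nat -> R) : (forall k, 0 <= f k) ->
  (\int[finite_counting]_k (f k)%:E = (\sum_(k < #|I|) f k)%:E)%E.
Proof.
move=> f0; rewrite ge0_integral_measure_sum//.
  rewrite -sumEFin; apply: eq_bigr => k _.
  by rewrite integral_dirac//= diracT mul1e.
by move=> k _; rewrite lee_fin.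
Qed.

Lemma finite_norm_ord_extend a : finite_norm finite_counting 1 (ord_extend a).
Proof.
rewrite /finite_norm Lnorm1 /=.
rewrite (integral_finite_counting (f := fun k => `|ord_extend a k|))//.
exact: ltry.
Qed.

Definition finite_L1 (a : I -> R) : LspaceType1 finite_counting :=
  L1class (finite_norm_ord_extend a).

Lemma L1dist_finite_L1 a b :
  L1dist (finite_L1 a) (finite_L1 b) = \sum_i `|a i - b i|.
Proof.
rewrite L1dist_class integral_finite_counting//=.
rewrite (reindex _ (onW_bij _ (@enum_val_bij I))) /=.
by apply: eq_bigr => k _; rewrite /ord_extend valK.
Qed.

End FiniteL1.

Lemma finite_l1_embedding (R : realType) (X : Type) (I : finType)
    (dX : X -> X -> R) (phi : X -> I -> R) (c C : R) :
  0 < c -> 0 < C -> injective phi ->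
  (forall u v, c * dX u v <= \sum_i `|phi u i - phi v i| <= C * dX u v) ->
  L1_embeds_with_distortion dX (C / c).
Proof.
move=> c0 C0 injphi phicC.
exists _, nat, (finite_counting R I), (fun u => finite_L1 (phi u)).
have FcC u v : c * dX u v <= L1dist (finite_L1 (phi u)) (finite_L1 (phi v))
    <= C * dX u v.
  by rewrite L1dist_finite_L1.
split; last exact: distortion_le (ltW C0) FcC.
split; last by exists c, C.
move=> u v uv; apply: injphi; apply/funext => i.
have /eqP := L1dist_finite_L1 (phi u) (phi v).
rewrite uv L1dist_finite_L1.
under eq_bigr do rewrite subrr normr0.
rewrite big1// eq_sym psumr_eq0// => /allP /(_ i).
rewrite mem_index_enum normr_eq0 subr_eq0.
by move=> /(_ isT)/eqP.
Qed.

Lemma L1dist_ge0 (R : realType) d (T : measurableType d)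
  (mu : {measure set T -> \bar R}) (f g : LspaceType1 mu) : 0 <= L1dist f g.
Proof. by rewrite fine_ge0// Lnorm_ge0. Qed.

(** The rescaling factor of the embedding is absorbed into the cut weights. *)
Lemma L1_embeds_cut_dist (R : realType) (M : finType) (d : M -> M -> R) (D : R) :
  is_metric d -> L1_embeds_with_distortion d D ->
  exists2 lambda : {set M} -> R, forall S, 0 <= lambda S &
  forall x y, d x y <= cut_dist lambda x y <= D * d x y.
Proof.
move=> [d_ge0 _ _ _] [disp [T [mu [F [bF FD]]]]].
have [b b0 Fb] := distortion_rescaling d_ge0 (@L1dist_ge0 _ _ _ _) bF.
have [lambda l0 lE] := L1dist_cut_decomposition F.
exists (fun S => b * lambda S) => [S|x y]; first by rewrite mulr_ge0.
rewrite cut_distZ -lE; have /andP[-> /le_trans] := Fb x y.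
by apply; rewrite ler_wpM2r.
Qed.

(** * Bounds on shortest path distances *)

Section ShortestPath.
Context (R : realType) (V : eqType) (e : rel V) (w : V -> V -> R).
Hypothesis w_ge0 : forall u v, e u v -> 0 <= w u v.

Lemma path_weight_ge0 u p : path e u p -> 0 <= \sum_(a <- pairmap w u p) a.
Proof.
elim: p u => [|v p IH] u /=; first by rewrite big_nil.
by move=> /andP[uv /IH]; rewrite big_cons; apply: addr_ge0; exact: w_ge0.
Qed.

Lemma shortest_path_le u p : path e u p ->
  shortest_path_dist e w u (last u p) <= \sum_(a <- pairmap w u p) a.
Proof.
move=> up; apply: ge_inf; last by exists p.
by exists 0 => _ [q [uq _ ->]]; exact: path_weight_ge0.
Qed.

(** By the triangle inequality [rho u v] is at most the length of every walk. The given walk is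
    there because the infimum of the empty set is 0. *)
Lemma le_shortest_path (rho : V -> V -> R) u v :
  (forall t, rho t t = 0) -> (forall s t z, rho s z <= rho s t + rho t z) ->
  (forall s t, e s t -> rho s t <= w s t) ->
  (exists2 p, path e u p & last u p = v) ->
  rho u v <= shortest_path_dist e w u v.
Proof.
move=> rho0 rhoD rhow [p0 up0 p0v].
apply: lb_le_inf; first by exists (\sum_(a <- pairmap w u p0) a), p0.
move=> _ [p [up pv ->]] {p0 up0 p0v}.
elim: p u up pv => [|t p IH] u /=; first by move=> _ ->; rewrite big_nil rho0.
move=> /andP[ut tp] pv; rewrite big_cons.
by apply: le_trans (rhoD u t v) _; apply: lerD; [exact: rhow|exact: IH].
Qed.

End ShortestPath.

(** * The embedding of the twisted union *)

Section TwistedUnion.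
Context (R : realType) (M : finType) (r : R) (d0 d1 : M -> M -> R).
Context (D0 D1 K : R) (lambda lambda0 lambda1 : {set M} -> R).
Hypotheses (r0 : 0 < r) (K1 : 1 <= K).
Hypotheses (d0_metric : is_metric d0) (d1_metric : is_metric d1).
Hypothesis d01 : forall x y, `|d0 x y - d1 x y| <= 2 * r.
Hypothesis lambda_ge0 : forall S, 0 <= lambda S.
Hypothesis lambda0_ge0 : forall S, 0 <= lambda0 S.
Hypothesis lambda1_ge0 : forall S, 0 <= lambda1 S.
Hypothesis lambdaP : forall x y, Num.min (d0 x y) (d1 x y) <=
  cut_dist lambda x y <= K * Num.min (d0 x y) (d1 x y).
Hypothesis lambda0P : forall x y,
  d0 x y <= cut_dist lambda0 x y <= D0 * d0 x y.
Hypothesis lambda1P : forall x y,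
  d1 x y <= cut_dist lambda1 x y <= D1 * d1 x y.

(** Cut weights for [d0 / r] ([b] true) or [d1 / r] ([b] false), up to the factor [D0] or [D1]. *)
Let layer (b : bool) (S : {set M}) : R :=
  r^-1 * (if b then lambda0 S else lambda1 S).

Let layer_ge0 b S : 0 <= layer b S.
Proof. by rewrite mulr_ge0 ?invr_ge0 ?(ltW r0)//; case: b. Qed.

(* The block of [G_i] is indexed by the truth value of [i == 0]. *)
Definition twisted_embedding (u : M * 'F_2)
    (i : {set M} + (({set {set M}} * {set {set M}}) * bool)) : R :=
  match i with
  | inl A => lambda A * (u.1 \in A)%:R
  | inr (EV, b) =>
      if (u.2 == 0) == b then r * random_cuts (layer b) u.1 EV else 0
  end.

Let delta u v : R := \sum_i `|twisted_embedding u i - twisted_embedding v i|.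

Lemma twisted_embedding_dist u v : delta u v = cut_dist lambda u.1 v.1 +
  (if u.2 == v.2 then r * (2 * saturation (layer (u.2 == 0)) u.1 v.1)
   else 2 * r).
Proof.
have r_ge0 := ltW r0.
rewrite /delta big_sumType /=; congr (_ + _).
  apply: eq_bigr => S _; rewrite -mulrBr normrM ger0_norm//; congr (_ * _).
  by case: (u.1 \in S); case: (v.1 \in S);
    rewrite ?subrr ?normr0 ?subr0 ?sub0r ?normrN ?normr1.
transitivity (\sum_EV \sum_b
    `|twisted_embedding u (inr (EV, b)) - twisted_embedding v (inr (EV, b))|).
  by rewrite pair_bigA; apply: eq_bigr => -[EV b] _.
rewrite exchange_big /= big_bool /=.
(* As 'F_2 has two elements, testing against 0 determines the layer. *)
have uvE : (u.2 == v.2) = ((u.2 == 0) == (v.2 == 0)).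
  by case: u.2 => -[|[|?]] ?; case: v.2 => -[|[|?]] ?.
rewrite uvE; case: (u.2 == 0); case: (v.2 == 0) => /=.
- rewrite [X in _ + X]big1 ?addr0 => [|EV _]; last by rewrite subrr normr0.
  rewrite -random_cuts_dist// mulr_sumr; apply: eq_bigr => EV _.
  by rewrite -mulrBr normrM ger0_norm.
- under eq_bigr => EV _ do rewrite subr0 normrM (ger0_norm r_ge0).
  under [X in _ + X]eq_bigr => EV _ do rewrite sub0r normrN normrM (ger0_norm r_ge0).
  by rewrite -!mulr_sumr !sum_random_cuts//; lra.
- under eq_bigr => EV _ do rewrite sub0r normrN normrM (ger0_norm r_ge0).
  under [X in _ + X]eq_bigr => EV _ do rewrite subr0 normrM (ger0_norm r_ge0).
  by rewrite -!mulr_sumr !sum_random_cuts//; lra.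
- under eq_bigr do rewrite subrr normr0.
  rewrite big1_eq add0r.
  rewrite -random_cuts_dist// mulr_sumr; apply: eq_bigr => EV _.
  by rewrite -mulrBr normrM ger0_norm.
Qed.

Let e := @twisted_edge M.
Let w := twisted_weight d0 d1 r.
(** On an edge inside a layer, K bounds the part from psi and [2 * (|D0| + |D1|)] the truncated
    part; the final 2 covers the edges of weight r. *)
Let C : R := K + 2 * `|D0| + 2 * `|D1| + 2.

Let C_ge2 : 2 <= C.
Proof.
by have [n0 n1] := (normr_ge0 D0, normr_ge0 D1); have := K1; rewrite /C; lra.
Qed.

Let d_ge0 (i : 'F_2) x y : 0 <= if i == 0 then d0 x y else d1 x y.
Proof. by case: ifP => _; [case: d0_metric|case: d1_metric]. Qed.

Lemma twisted_weight_ge0 u v : 0 <= w u v.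
Proof. by rewrite /w /twisted_weight; case: ifP => _; rewrite ?d_ge0 ?ltW. Qed.

(** This is [saturation_bounds] at cut distance [t / r], multiplied by r, with t between d and
    [(|D0| + |D1|) * d]. *)
Let layerP b x y :
  let d := if b then d0 x y else d1 x y in
  Num.min r d <= r * (2 * saturation (layer b) x y) <= 2 * (`|D0| + `|D1|) * d.
Proof.
have [d0_ge0 d1_ge0] := (d_ge0 0 x y, d_ge0 1 x y); rewrite /= in d0_ge0 d1_ge0.
set t := cut_dist (if b then lambda0 else lambda1) x y.
have -> : saturation (layer b) x y =
    saturation (fun A => r^-1 * (if b then lambda0 else lambda1) A) x y.
  by rewrite /saturation /layer; case: (b).
have l0 A : 0 <= r^-1 * (if b then lambda0 else lambda1) A.
  by rewrite mulr_ge0 ?invr_ge0 ?(ltW r0)//; case: (b).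
have /andP[] := saturation_bounds x y l0; rewrite cut_distZ -/t => lo up.
have rt : r * (r^-1 * t) = t by rewrite mulrA divff ?mul1r// gt_eqF.
have [n0 n1] := (ler_norm D0, ler_norm D1).
have [m0 m1] := (normr_ge0 D0, normr_ge0 D1).
have td : (if b then d0 x y else d1 x y) <= t
    <= (`|D0| + `|D1|) * (if b then d0 x y else d1 x y).
  rewrite /t; case: (b).
    by have /andP[-> /le_trans] := lambda0P x y; apply; rewrite ler_wpM2r//; lra.
  by have /andP[-> /le_trans] := lambda1P x y; apply; rewrite ler_wpM2r//; lra.
case/andP: td => td1 td2; apply/andP; split.
  move: lo; rewrite -(ler_pM2l r0) minr_pMr ?(ltW r0)// rt mulr1.
  by apply: le_trans; rewrite le_min ge_min lexx /= ge_min td1 orbT.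
move: up; rewrite -(ler_pM2l r0) mulrCA [X in _ <= X]mulrCA rt mulrCA => /le_trans.
by apply; lra.
Qed.

Lemma twisted_embedding_edge u v : e u v -> delta u v <= C * w u v.
Proof.
case: u v => x i [y j]; rewrite /e /twisted_edge /= twisted_embedding_dist.
rewrite /w /twisted_weight /=.
have [n0 n1] := (normr_ge0 D0, normr_ge0 D1).
have [_ e0] := andP (lambdaP x y).
have [|_ /= /eqP <-] := eqVneq i j => [_ _|].
  have := d_ge0 i x y; have /andP[_] := layerP (i == 0) x y.
  have : Num.min (d0 x y) (d1 x y) <= if i == 0 then d0 x y else d1 x y.
    by case: ifP; rewrite ge_min lexx ?orbT.
  rewrite /=; set d := if _ then _ else _; set m := Num.min _ _ in e0 *.
  move=> md sd d0'.
  have := ler_wpM2l (le_trans ler01 K1) md.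
  rewrite /C; lra.
have -> : cut_dist lambda x x = 0 by apply: big1 => A _; rewrite eqxx mulr0.
by rewrite add0r; exact: (ler_wpM2r (ltW r0) C_ge2).
Qed.

(** Explicit walks suffice. Let m be the smaller of the two distances. In one layer, [d <= m + 2 r]
    and [delta >= m + min(r, d)], so [d <= 2 delta]. Across layers, the walk has length at most
    [m + 3 r], while [delta >= m + 2 r]. *)
Lemma twisted_embedding_lower u v :
  twisted_union_dist d0 d1 r u v <= 2 * delta u v.
Proof.
have le_path :=
  shortest_path_le (e := e) (w := w) (fun u v _ => twisted_weight_ge0 u v).
case: u v => x i [y j]; rewrite twisted_embedding_dist /=.
have r_gt0 := r0.
have [m_le _] := andP (lambdaP x y).
have := d01 x y; rewrite ler_norml => /andP[lo up].
have d_le : (if i == 0 then d0 x y else d1 x y) <=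
    Num.min (d0 x y) (d1 x y) + 2 * r.
  by case: ifP => _; rewrite minElt; case: ifP => _; lra.
have [ij|ij] := eqVneq i j.
  have /andP[s_ge _] := layerP (i == 0) x y.
  have := le_path (x, i) [:: (y, j)].
  rewrite /= /e /twisted_edge /= ij eqxx /= => /(_ isT).
  rewrite big_cons big_nil addr0 /w /twisted_weight /= eqxx -ij => /le_trans; apply.
  move: s_ge; rewrite /=; set d := if _ then _ else _ in d_le *.
  have := d_ge0 i x y; rewrite -/d; set m := Num.min (d0 x y) _ in m_le d_le *.
  have m0 : 0 <= m by rewrite le_min (d_ge0 0) (d_ge0 1).
  by rewrite minElt; case: ifP => _; lra.
have := le_path (x, i) [:: (y, i); (y, j)].
rewrite /= /e /twisted_edge /= !eqxx orbT /= => /(_ isT).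
rewrite !big_cons big_nil addr0 /w /twisted_weight /= eqxx (negPf ij).
move=> /le_trans; apply.
have m0 : 0 <= Num.min (d0 x y) (d1 x y).
  by rewrite le_min (d_ge0 0) (d_ge0 1).
lra.
Qed.

(** If [delta] vanishes, the layers agree, since otherwise it is at least [2 r]; then
    [min(r, d) <= 0] with [r > 0] forces [d = 0]. *)
Lemma twisted_embedding_inj : injective twisted_embedding.
Proof.
move=> [x i] [y j] xy.
have r_gt0 := r0.
have : delta (x, i) (y, j) = 0.
  by rewrite /delta xy big1// => k _; rewrite subrr normr0.
move=> {xy}; rewrite twisted_embedding_dist /=.
have [m_le _] := andP (lambdaP x y).
have m0 : 0 <= Num.min (d0 x y) (d1 x y).
  by rewrite le_min (d_ge0 0) (d_ge0 1).
have [<-|_] := eqVneq i j; last by move=> ?; exfalso; lra.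
have /andP[s_ge _] := layerP (i == 0) x y => s0.
have d_le0 : (if i == 0 then d0 x y else d1 x y) <= 0.
  by move: s_ge; rewrite /= minElt; case: ifP => _; lra.
have d_eq0 : (if i == 0 then d0 x y else d1 x y) = 0.
  by apply/eqP; rewrite eq_le d_le0 d_ge0.
congr (_, _); move: d_eq0; case: ifP => _.
  by case: d0_metric => _ + _ _ => /(_ x y)[+ _]; apply.
by case: d1_metric => _ + _ _ => /(_ x y)[+ _]; apply.
Qed.

(* [delta / C] is a metric that does not exceed the weight on the edges. *)
Lemma twisted_embedding_upper u v :
  delta u v <= C * twisted_union_dist d0 d1 r u v.
Proof.
have C0 : 0 < C by exact: lt_le_trans C_ge2.
rewrite mulrC -ler_pdivrMr//.
apply: (le_shortest_path (rho := fun u v => delta u v / C)) => [t|s t z|s t st|].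
- by rewrite /delta big1 ?mul0r// => k _; rewrite subrr normr0.
- rewrite -mulrDl ler_wpM2r ?invr_ge0 ?(ltW C0)// /delta -big_split /=.
  by apply: ler_sum => k _; exact: ler_distD.
- by rewrite ler_pdivrMr// mulrC; exact: twisted_embedding_edge.
- exists [:: (v.1, u.2); v] => //.
  by rewrite /= /twisted_edge /= !eqxx orbT.
Qed.

Lemma L1_embeds_twisted_union :
  L1_embeds_with_distortion (twisted_union_dist d0 d1 r) (C / 2^-1).
Proof.
have C0 : 0 < C by exact: lt_le_trans C_ge2.
apply: (finite_l1_embedding _ C0 twisted_embedding_inj); first lra.
move=> u v; rewrite twisted_embedding_upper andbT.
have := twisted_embedding_lower u v; rewrite /delta; lra.
Qed.

End TwistedUnion.

Theorem theorem4p1 (R : realType) (D0 D1 K : R) (hK : 1 <= K) :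
  exists D : R,
  forall (r : R) (M : finType) (d0 d1 : M -> M -> R)
    (disp : measure_display) (T : measurableType disp)
    (mu : {measure set T -> \bar R}) (psi : M -> LspaceType1 mu),
    0 < r ->
    is_metric d0 -> is_metric d1 ->
    (forall x y : M, `|d0 x y - d1 x y| <= 2 * r) ->
    L1_embeds_with_distortion d0 D0 ->
    L1_embeds_with_distortion d1 D1 ->
    (forall x y : M,
      Num.min (d0 x y) (d1 x y) <= L1dist (psi x) (psi y)
        <= K * Num.min (d0 x y) (d1 x y)) ->
    L1_embeds_with_distortion (twisted_union_dist d0 d1 r) D.
Proof.
(* The ratio of the upper constant C to the lower constant 1/2 of the embedding. *)
exists ((K + 2 * `|D0| + 2 * `|D1| + 2) / 2^-1).
move=> r M d0 d1 disp T mu psi r0 d0m d1m d01 emb0 emb1 psiP.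
have [lambda0 l0_ge0 l0P] := L1_embeds_cut_dist d0m emb0.
have [lambda1 l1_ge0 l1P] := L1_embeds_cut_dist d1m emb1.
have [lambda l_ge0 lE] := L1dist_cut_decomposition psi.
apply: (L1_embeds_twisted_union r0 hK d0m d1m d01 l_ge0 l0_ge0 l1_ge0 _ l0P l1P).
by move=> x y; rewrite -lE.
Qed.
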